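(* Let $\mathcal{P}$ be a non-overlapping PTRS. Then for each $X\in\{\mathtt{AST},\mathtt{PAST},\mathtt{SAST}\}$: $X(\xrightarrow{\mathbf{i}}_{\mathcal{P}})$ holds iff $X(\xrightarrow{\mathbf{li}}_{\mathcal{P}})$ holds.
   Context: Terms $\mathcal{T}$ over a countable signature and countable variable set. A finite multi-distribution on $A\ne\emptyset$ is a finite multiset $\mu$ of pairs $(p:a)$, $0<p\le1$, $a\in A$, probabilities summing to $1$; $\mathrm{FDist}(A)$ the set, $\mathrm{Supp}(\mu)$ the multiset of elements, $p\cdot\mu=\{(pq:a)\mid(q:a)\in\mu\}$. A PTRS is a countable set $\mathcal{P}$ of rules $\ell\to\mu$ with $\ell$ a non-variable term, $\mu\in\mathrm{FDist}(\mathcal{T})$, $\mathcal{V}(r)\subseteq\mathcal{V}(\ell)$ for $r\in\mathrm{Supp}(\mu)$. $s\to_{\mathcal{P}}\{p_1:t_1,\dots,p_k:t_k\}$ via position $\pi$, rule $\ell\to\{p_1:r_1,\dots,p_k:r_k\}$ and substitution $\sigma$ if $s|_\pi=\ell\sigma$ and $t_j=s[r_j\sigma]_\pi$; normal forms are terms admitting no such step. The step is innermost ($\xrightarrow{\mathbf{i}}_{\mathcal{P}}$) if all proper subterms of $\ell\sigma$ are normal forms, and leftmost-innermost ($\xrightarrow{\mathbf{li}}_{\mathcal{P}}$) if it is innermost and $s$ has no redex (instance of a left-hand side) at a position $\tau$ parallel to $\pi$ and left of it (at the first index where $\tau,\pi$ differ, $\tau$ has the smaller number). Lifting of $\to$: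 smallest $\rightrightarrows$ on $\mathrm{FDist}(\mathcal{T})$ with $\{1:t\}\rightrightarrows\{1:t\}$ for $\to$-normal forms $t$, $\{1:t\}\rightrightarrows\mu$ if $t\to\mu$, and $\bigcup_jp_j\cdot\mu_j\rightrightarrows\bigcup_jp_j\cdot\nu_j$ if $\mu_j\rightrightarrows\nu_j$, $0<p_j\le1$, $\sum p_j=1$. $|\mu|_\to$ = total probability of normal forms in $\mu$; $\mathrm{edl}((\mu_n))=\sum_{n\ge0}(1-|\mu_n|_\to)$. $\mathtt{AST}(\to)$: all infinite $\rightrightarrows$-sequences have $\lim|\mu_n|_\to=1$. $\mathtt{PAST}(\to)$: all infinite $\rightrightarrows$-sequences with $\mu_0=\{1:t\}$ have finite $\mathrm{edl}$. $\mathrm{edh}_\to(t)=\sup$ of $\mathrm{edl}$ over infinite $\rightrightarrows$-sequences with $\mu_0=\{1:t\}$; $\mathtt{SAST}(\to)$: $\mathrm{edh}_\to(t)<\infty$ for all terms $t$. Non-overlapping: no two rules (renamed apart) and non-variable position $\pi$ of the first left-hand side $\ell_1$ such that $\ell_1|_\pi$ unifies with the second left-hand side (with $\pi\ne\varepsilon$ if it is the same rule). *)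

(* Defs.v *)
From HB Require Import structures.
From mathcomp Require Import all_boot all_order all_algebra.
From mathcomp Require Import finmap multiset.
From mathcomp Require Import all_classical all_reals all_analysis.

Set Implicit Arguments.
Unset Strict Implicit.
Unset Printing Implicit Defensive.
Import Order.TTheory GRing.Theory Num.Theory.
Import numFieldNormedType.Exports.
Local Open Scope classical_set_scope.
Local Open Scope ring_scope.

Inductive term (F : Type) (ar : F -> nat) (V : Type) : Type :=
| Var of V
| App (f : F) of ('I_(ar f) -> term ar V).
Arguments Var {F ar V}.
Arguments App {F ar V} f.

HB.instance Definition _ (F : Type) (ar : F -> nat) (V : Type) :=
  gen_eqMixin (term ar V).
HB.instance Definition _ (F : Type) (ar : F -> nat) (V : Type) :=
  gen_choiceMixin (term ar V).

Section Terms.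
Context {F : Type} {ar : F -> nat}.

Definition is_var V (t : term ar V) : bool := if t is Var _ then true else false.

Fixpoint vars V (t : term ar V) : set V :=
  match t with
  | Var x => [set x]
  | App f ts => \bigcup_i vars (ts i)
  end.

Fixpoint subst V W (sigma : V -> term ar W) (t : term ar V) : term ar W :=
  match t with
  | Var x => sigma x
  | App f ts => App f (fun i => subst sigma (ts i))
  end.

(* Positions are sequences of argument indices, counted from 0; [None] means
   that the sequence is not a position of the term. *)
Fixpoint subterm_at V (t : term ar V) (pi : seq nat) : option (term ar V) :=
  match pi with
  | [::] => Some t
  | i :: pi' =>
      match t with
      | Var _ => None
      | App f ts =>
          if insub i is Some j then subterm_at (ts j) pi' else None
      end
  end.

(* [t] is returned unchanged if [pi] is not a position of [t]. *)
Fixpoint replace_at V (t : term ar V) (pi : seq nat) (u : term ar V) :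
    term ar V :=
  match pi with
  | [::] => u
  | i :: pi' =>
      match t with
      | Var _ => t
      | App f ts =>
          App f (fun j => if val j == i then replace_at (ts j) pi' u else ts j)
      end
  end.

(* Two terms over the same variables are renamed apart by tagging the variables
   of the first with [inl] and those of the second with [inr]. *)
Definition unify_apart V (s t : term ar V) : Prop :=
  exists sigma : V + V -> term ar (V + V)%type,
    subst sigma (subst (Var \o inl) s) = subst sigma (subst (Var \o inr) t).

End Terms.

(* The two positions first differ after the common prefix [rho]; in particular
   they are parallel. *)
Definition left_of (tau pi : seq nat) : Prop :=
  exists (rho tau' pi' : seq nat) (i j : nat),
    [/\ tau = rho ++ i :: tau', pi = rho ++ j :: pi' & (i < j)%N].

Section MultiDistributions.
Context {R : realType}.

Definition multidist (A : choiceType) : Type := {mset (R * A)%type}%mset.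

Definition FDist (A : choiceType) : set (multidist A) :=
  [set mu | (forall x, x \in enum_mset mu -> 0 < x.1 <= 1) /\
            \sum_(x <- enum_mset mu) x.1 = 1].

Definition dirac_mdist (A : choiceType) (a : A) : multidist A := [mset (1, a)]%mset.

Definition scale_mdist (A : choiceType) (p : R) (mu : multidist A) : multidist A :=
  seq_mset [seq (p * x.1, x.2) | x <- enum_mset mu].

Definition map_mdist (A B : choiceType) (f : A -> B) (mu : multidist A) : multidist B :=
  seq_mset [seq (x.1, f x.2) | x <- enum_mset mu].

Definition conv_mdist (A : choiceType) (k : nat) (p : 'I_k -> R)
    (mu : 'I_k -> multidist A) : multidist A :=
  \big[msetD/mset0]_(j < k) scale_mdist (p j) (mu j).

Context {A : choiceType}.
Implicit Types (step : A -> multidist A -> Prop).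

Definition normal_form step (a : A) : Prop := ~ exists mu, step a mu.

Inductive dlift step : multidist A -> multidist A -> Prop :=
| dlift_nf a : normal_form step a -> dlift step (dirac_mdist a) (dirac_mdist a)
| dlift_step a mu : step a mu -> dlift step (dirac_mdist a) mu
| dlift_conv k (p : 'I_k -> R) (mu nu : 'I_k -> multidist A) :
    (forall j, 0 < p j <= 1) -> \sum_(j < k) p j = 1 ->
    (forall j, dlift step (mu j) (nu j)) ->
    dlift step (conv_mdist p mu) (conv_mdist p nu).

Definition dlift_seq step (mu : nat -> multidist A) : Prop :=
  forall n, FDist (mu n) /\ dlift step (mu n) (mu n.+1).

Definition nf_prob step (mu : multidist A) : R :=
  \sum_(x <- enum_mset mu | `[< normal_form step x.2 >]) x.1.

Definition edl step (mu : nat -> multidist A) : \bar R :=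
  (\sum_(0 <= n <oo) (1 - nf_prob step (mu n))%:E)%E.

Definition edh step (a : A) : \bar R :=
  ereal_sup [set edl step mu | mu in
    [set mu | dlift_seq step mu /\ mu 0%N = dirac_mdist a]].

Definition AST step : Prop :=
  forall mu : nat -> multidist A, dlift_seq step mu ->
    nf_prob step (mu n) @[n --> \oo] --> (1 : R).

Definition PAST step : Prop :=
  forall (mu : nat -> multidist A) (a : A), dlift_seq step mu -> mu 0%N = dirac_mdist a ->
    (edl step mu < +oo)%E.

Definition SAST step : Prop := forall a, (edh step a < +oo)%E.

End MultiDistributions.
Arguments multidist : clear implicits.

Section PTRS.
Context {R : realType} {F : Type} {ar : F -> nat} {V : Type}.

Definition rule : Type := (term ar V * multidist R (term ar V))%type.
Implicit Types (P : set rule) (s t : term ar V) (mu : multidist R (term ar V)).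

Definition is_PTRS P : Prop :=
  countable P /\
  forall r, P r ->
    [/\ ~~ is_var r.1, FDist r.2 &
        forall x, x \in enum_mset r.2 -> vars x.2 `<=` vars r.1].

Definition nonoverlapping P : Prop :=
  forall (r1 r2 : rule) (pi : seq nat) (u : term ar V),
    P r1 -> P r2 -> subterm_at r1.1 pi = Some u -> ~~ is_var u ->
    (r1 = r2 -> pi <> [::]) ->
    ~ unify_apart u r2.1.

Definition step_at P (pi : seq nat) (r : rule) (sigma : V -> term ar V)
    s mu : Prop :=
  [/\ P r, subterm_at s pi = Some (subst sigma r.1) &
      mu = map_mdist (fun t => replace_at s pi (subst sigma t)) r.2].

Definition step P s mu : Prop :=
  exists pi r sigma, step_at P pi r sigma s mu.

Definition redex P t : Prop :=
  exists r sigma, P r /\ t = subst sigma r.1.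

Definition innermost_at P (pi : seq nat) (r : rule) (sigma : V -> term ar V)
    s mu : Prop :=
  step_at P pi r sigma s mu /\
  forall tau t, tau <> [::] -> subterm_at (subst sigma r.1) tau = Some t ->
    normal_form (step P) t.

Definition istep P s mu : Prop :=
  exists pi r sigma, innermost_at P pi r sigma s mu.

Definition listep P s mu : Prop :=
  exists pi r sigma, innermost_at P pi r sigma s mu /\
    forall tau t, left_of tau pi -> subterm_at s tau = Some t -> ~ redex P t.

End PTRS.
Arguments rule R {F} ar V.

(* Main.v *)
Require Import Defs.
From mathcomp Require Import all_boot all_order all_algebra.
From mathcomp Require Import finmap multiset.
From mathcomp Require Import all_classical all_reals all_analysis.

(* Two innermost redexes of a term are either equal or parallel, and by
   non-overlappingness the contractum of an innermost redex is determined by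
   its position.  Hence innermost rewriting has a one-step diamond property,
   which yields "random descent": the probability of having reached a normal
   form after exactly n steps depends on the initial distribution only, not on
   the chosen reductions.  Leftmost-innermost rewriting is a sub-relation with
   the same normal forms, so every innermost sequence is matched by a
   leftmost-innermost one with the same normal form probabilities at each
   step, and these determine AST, PAST and SAST. *)

Set Implicit Arguments.
Unset Strict Implicit.
Unset Printing Implicit Defensive.
Import Order.TTheory GRing.Theory Num.Theory.
Import numFieldNormedType.Exports.
Local Open Scope classical_set_scope.
Local Open Scope ring_scope.

(** * Expectations over multi-distributions *)

Section Expectation.
Context {R : realType}.

Definition expect (A : choiceType) (mu : multidist R A) (g : A -> R) : R :=
  \sum_(x <- enum_mset mu) x.1 * g x.2.

Lemma perm_enum_msetD (K : choiceType) (X Y : {mset K}%mset) :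
  perm_eq (enum_mset (msetD X Y)) (enum_mset X ++ enum_mset Y).
Proof.
apply/allP => a _ /=; apply/eqP.
by rewrite count_cat !count_mem_mset msetE2.
Qed.

Lemma enum_mset1 (K : choiceType) (a : K) : enum_mset [mset a]%mset = [:: a].
Proof. exact: (enum_msetn 1 a). Qed.

Lemma expect_dirac (A : choiceType) (a : A) (g : A -> R) :
  expect (dirac_mdist a) g = g a.
Proof. by rewrite /expect enum_mset1 big_seq1 mul1r. Qed.

Lemma eq_expect (A : choiceType) (mu : multidist R A) (g h : A -> R) :
  (forall x, x \in enum_mset mu -> g x.2 = h x.2) -> expect mu g = expect mu h.
Proof.
move=> gh; rewrite /expect !big_seq; apply: eq_bigr => x xmu.
by rewrite gh.
Qed.

Lemma expect_map (A B : choiceType) (f : A -> B) (mu : multidist R A)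
    (g : B -> R) : expect (map_mdist f mu) g = expect mu (g \o f).
Proof. by rewrite /expect (perm_big _ (perm_eq_seq_mset _)) big_map. Qed.

Lemma expect_scale (A : choiceType) (p : R) (mu : multidist R A) (g : A -> R) :
  expect (scale_mdist p mu) g = p * expect mu g.
Proof.
rewrite /expect (perm_big _ (perm_eq_seq_mset _)) big_map mulr_sumr.
by apply: eq_bigr => x _; rewrite mulrA.
Qed.

Lemma expect_conv (A : choiceType) (k : nat) (p : 'I_k -> R)
    (mu : 'I_k -> multidist R A) (g : A -> R) :
  expect (conv_mdist p mu) g = \sum_j p j * expect (mu j) g.
Proof.
rewrite (big_morph (fun nu : multidist R A => expect nu g)
  (id1 := 0) (op1 := +%R)).
- by apply: eq_bigr => j _; rewrite expect_scale.
- by move=> X Y; rewrite /expect (perm_big _ (perm_enum_msetD _ _)) big_cat.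
- by rewrite /expect enum_mset0 big_nil.
Qed.

Lemma exchange_expect (A B : choiceType) (mu : multidist R A)
    (nu : multidist R B) (g : A -> B -> R) :
  expect mu (fun a => expect nu (g a)) =
  expect nu (fun b => expect mu (fun a => g a b)).
Proof.
rewrite /expect.
under eq_bigr do rewrite mulr_sumr.
rewrite exchange_big /=; apply: eq_bigr => y _; rewrite mulr_sumr.
by apply: eq_bigr => x _; rewrite mulrCA.
Qed.

Lemma FDistE (A : choiceType) (mu : multidist R A) :
  FDist mu <-> (forall x, x \in enum_mset mu -> 0 < x.1 <= 1) /\
               expect mu (fun=> 1) = 1.
Proof. by rewrite /expect; under eq_bigr do rewrite mulr1. Qed.

Lemma FDist_dirac (A : choiceType) (a : A) : FDist (dirac_mdist a : multidist R A).
Proof.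
apply/FDistE; split; last by rewrite expect_dirac.
by move=> x; rewrite enum_mset1 inE => /eqP ->; rewrite ltr01 lexx.
Qed.

Lemma FDist_map (A B : choiceType) (f : A -> B) (mu : multidist R A) :
  FDist mu -> FDist (map_mdist f mu).
Proof.
move=> /FDistE[mu01 mu1]; apply/FDistE; split; last by rewrite expect_map.
move=> x; rewrite (perm_mem (perm_eq_seq_mset _)) => /mapP[y ymu ->] /=.
exact: mu01.
Qed.

Lemma FDist_conv (A : choiceType) (k : nat) (p : 'I_k -> R)
    (mu : 'I_k -> multidist R A) :
  (forall j, 0 < p j <= 1) -> \sum_j p j = 1 -> (forall j, FDist (mu j)) ->
  FDist (conv_mdist p mu).
Proof.
move=> p01 p1 muP; apply/FDistE; split.
  rewrite /conv_mdist.
  elim/big_ind : _ => [x|X Y HX HY x|j _ x].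
  - by rewrite enum_mset0.
  - by rewrite (perm_mem (perm_enum_msetD _ _)) mem_cat => /orP[/HX|/HY].
  - rewrite (perm_mem (perm_eq_seq_mset _)) => /mapP[y ymu ->] /=.
    have /andP[p0 ple1] := p01 j; have /andP[y0 yle1] := (muP j).1 y ymu.
    by rewrite mulr_gt0 //= mulr_ile1 // ltW.
rewrite expect_conv -[RHS]p1; apply: eq_bigr => j _.
by have /FDistE[_ ->] := muP j; rewrite mulr1.
Qed.

(** This puts any multi-distribution into the shape required by [dlift_conv], so that a lifted step
    can be assembled from one choice per element. *)
Lemma conv_diracE (A : choiceType) (mu : multidist R A) :
  mu = conv_mdist (fun j : 'I_(size (enum_mset mu)) =>
                     (tnth (in_tuple (enum_mset mu)) j).1)
         (fun j => dirac_mdist (tnth (in_tuple (enum_mset mu)) j).2).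
Proof.
rewrite /conv_mdist -(big_tnth _ _ (enum_mset mu) xpredT
  (fun x => scale_mdist x.1 (dirac_mdist x.2))) -[LHS]seq_mset_id.
elim: (enum_mset mu) => [|x s IHs]; first by rewrite big_nil; apply/msetP => a;
  rewrite mset_seqE mset0E.
rewrite big_cons -IHs mset_cons; congr msetD.
rewrite /scale_mdist enum_mset1 /= mulr1 -surjective_pairing.
by apply/msetP => a; rewrite mset_seqE /= msetnE addn0 eq_sym; case: eqP.
Qed.

End Expectation.

(** * Random descent for an abstract probabilistic relation *)

Section RandomDescent.
Context {R : realType} {A : choiceType}.
Implicit Types (stp : A -> multidist R A -> Prop).

(** A distinct pair is joined by exactly one step on each side, which keeps the lengths of
    reductions equal. The joined results are compared only through expectations of all [g], which
    avoids identities between nested multisets. *)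
Definition diamond stp : Prop := forall a mu nu, stp a mu -> stp a nu ->
  mu = nu \/
  exists h k : A -> multidist R A,
    [/\ forall x, x \in enum_mset mu -> stp x.2 (h x.2),
        forall x, x \in enum_mset nu -> stp x.2 (k x.2) &
        forall g, expect mu (fun b => expect (h b) g) =
                  expect nu (fun b => expect (k b) g)].

(* The probability of having reached a normal form after [n] steps, along an
   arbitrarily chosen reduction. *)
Fixpoint nf_after stp (n : nat) (a : A) : R :=
  match n with
  | 0 => `[< normal_form stp a >]%:R
  | n'.+1 => if pselect (exists mu, stp a mu) is left e
             then expect (projT1 (cid e)) (nf_after stp n') else 1
  end.

Lemma nf_after_nf stp n a : normal_form stp a -> nf_after stp n a = 1.
Proof. by case: n => [|n] /= nfa; [rewrite asboolT | case: pselect]. Qed.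

(** Induction on [n]: the steps selected by choice inside [nf_after] may be exchanged for the
    joining steps [h] and [k], whose expectations agree. *)
Lemma nf_after_indep stp n a mu nu : diamond stp -> stp a mu -> stp a nu ->
  expect mu (nf_after stp n) = expect nu (nf_after stp n).
Proof.
move=> dia; elim: n => [|n IHn] in a mu nu *.
  move=> amu anu; have [->//|[h [k [hP kP _]]]] := dia _ _ _ amu anu.
  (* Every element on either side of a proper peak can still step, so both normal form probabilities
     are 0. *)
  have E0 rho l : (forall x, x \in enum_mset rho -> stp x.2 (l x.2)) ->
      expect rho (nf_after stp 0) = expect rho (fun=> 0).
    by move=> lP; apply: eq_expect => x xrho /=; rewrite asboolF// => -[];
      exists (l x.2); exact: lP.
  by rewrite (E0 _ _ hP) (E0 _ _ kP) /expect !big1// => x _; rewrite mulr0.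
move=> amu anu; have [->//|[h [k [hP kP hk]]]] := dia _ _ _ amu anu.
(* The induction hypothesis, applied at each element of [rho], replaces the chosen step by [l]. *)
have ES rho l : (forall x, x \in enum_mset rho -> stp x.2 (l x.2)) ->
    expect rho (nf_after stp n.+1) =
    expect rho (fun b => expect (l b) (nf_after stp n)).
  move=> lP; apply: eq_expect => x xrho /=; case: pselect => [e|[]].
    by case: cid => rho' /= /IHn; apply; exact: lP.
  by exists (l x.2); exact: lP.
by rewrite (ES _ _ hP) (ES _ _ kP) hk.
Qed.

Lemma nf_after_step stp n a mu : diamond stp -> stp a mu ->
  nf_after stp n.+1 a = expect mu (nf_after stp n).
Proof.
move=> dia amu /=; case: pselect => [e|[]]; last by exists mu.
by case: cid => nu /= anu; exact: nf_after_indep dia anu amu.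
Qed.

Lemma nf_after_dlift stp n mu nu : diamond stp -> dlift stp mu nu ->
  expect mu (nf_after stp n.+1) = expect nu (nf_after stp n).
Proof.
move=> dia; elim=> [a nfa|a rho arho|k p mu' nu' _ _ _ IH].
- by rewrite !expect_dirac !nf_after_nf.
- by rewrite expect_dirac (nf_after_step _ dia arho).
- by rewrite !expect_conv; apply: eq_bigr => j _; rewrite IH.
Qed.

Lemma nf_probE stp mu : nf_prob stp mu = expect mu (nf_after stp 0).
Proof.
rewrite /nf_prob /expect big_mkcond; apply: eq_bigr => x _ /=.
by case: ifP; rewrite ?mulr1 ?mulr0.
Qed.

Lemma nf_prob_dlift_seq stp mu n : diamond stp -> dlift_seq stp mu ->
  nf_prob stp (mu n) = expect (mu 0%N) (nf_after stp n).
Proof.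
move=> dia muP; rewrite nf_probE.
(* The start [m] is kept general, since the induction on [n] trades one step of the sequence for one
   unit of [nf_after]. *)
suff E m : expect (mu (m + n)%N) (nf_after stp 0) = expect (mu m) (nf_after stp n).
  exact: (E 0%N).
elim: n m => [|n IHn] m; first by rewrite addn0.
by rewrite addnS -addSn IHn (nf_after_dlift _ dia (muP m).2).
Qed.

Lemma dlift_FDist stp mu nu : (forall a rho, stp a rho -> FDist rho) ->
  dlift stp mu nu -> FDist nu.
Proof.
move=> stpF; elim=> [a _|a rho /stpF//|k p mu' nu' p01 p1 _ IH].
  exact: FDist_dirac.
exact: FDist_conv.
Qed.

Lemma dlift_total stp mu : FDist mu -> exists nu, dlift stp mu nu.
Proof.
move=> [mu01 mu1].
have /choice[f fP] : forall a, exists nu, dlift stp (dirac_mdist a) nu.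
  move=> a; have [[nu anu]|nfa] := pselect (exists nu, stp a nu).
    by exists nu; exact: dlift_step.
  by exists (dirac_mdist a); exact: dlift_nf.
rewrite (conv_diracE mu); eexists; apply: dlift_conv => [j||j]; last exact: fP.
  by apply: mu01; rewrite mem_tnth.
by rewrite -[RHS]mu1 [RHS]big_tnth.
Qed.

Lemma dlift_seq_ex stp mu0 : (forall a rho, stp a rho -> FDist rho) ->
  FDist mu0 -> exists2 mu, dlift_seq stp mu & mu 0%N = mu0.
Proof.
move=> stpF mu0F.
(* The successor function is total, with an irrelevant value outside [FDist]; its iterates from
   [mu0] never leave [FDist]. *)
have /choice[f fP] : forall mu, exists nu, FDist mu -> dlift stp mu nu.
  move=> mu; have [/(dlift_total stp)[nu ?]|?] := pselect (FDist mu).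
    by exists nu.
  by exists mu.
exists (fun n => iter n f mu0) => //.
have itF n : FDist (iter n f mu0).
  by elim: n => //= n IHn; exact: dlift_FDist stpF (fP _ IHn).
by move=> n; split => //=; exact: fP.
Qed.

(** * Strategies: sub-relations with the same normal forms *)

Section Strategy.
Variables stp sub : A -> multidist R A -> Prop.
Hypothesis sub_stp : forall a mu, sub a mu -> stp a mu.
Hypothesis stp_sub : forall a mu, stp a mu -> exists nu, sub a nu.

Lemma normal_form_sub a : normal_form sub a <-> normal_form stp a.
Proof.
split=> nfa [mu amu]; apply: nfa; first exact: stp_sub amu.
by exists mu; exact: sub_stp.
Qed.

Lemma nf_prob_sub mu : nf_prob sub mu = nf_prob stp mu.
Proof. by apply: eq_bigl => x; apply: asbool_equiv_eq; exact: normal_form_sub. Qed.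

Lemma dlift_seq_sub mu : dlift_seq sub mu -> dlift_seq stp mu.
Proof.
move=> muP n; split; first exact: (muP n).1.
elim: (muP n).2 => [a /normal_form_sub|a rho /sub_stp|k p mu' nu' p01 p1 _ IH].
- exact: dlift_nf.
- exact: dlift_step.
- exact: dlift_conv.
Qed.

Hypothesis stpF : forall a mu, stp a mu -> FDist mu.
Hypothesis stp_dia : diamond stp.

(** No step-by-step simulation takes place: any [sub]-sequence with the same start will do, because
    it is also an [stp]-sequence and random descent fixes its normal form probabilities. *)
Lemma strategy_simulation mu : dlift_seq stp mu ->
  exists nu, [/\ dlift_seq sub nu, nu 0%N = mu 0%N &
                 (fun n => nf_prob sub (nu n)) = (fun n => nf_prob stp (mu n))].
Proof.
move=> muP.
have subF a rho : sub a rho -> FDist rho by move=> /sub_stp /stpF.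
have [nu nuP nu0] := dlift_seq_ex subF (muP 0%N).1.
exists nu; split => //; apply/funext => n.
rewrite nf_prob_sub (nf_prob_dlift_seq _ stp_dia muP) -nu0.
exact: nf_prob_dlift_seq stp_dia (dlift_seq_sub nuP).
Qed.

Lemma edl_sub mu : edl sub mu = edl stp mu.
Proof. by rewrite /edl; under eq_eseriesr do rewrite nf_prob_sub. Qed.

Lemma strategy_simulation_edl mu : dlift_seq stp mu ->
  exists nu, [/\ dlift_seq sub nu, nu 0%N = mu 0%N & edl sub nu = edl stp mu].
Proof.
move=> /strategy_simulation[nu [nuP nu0 /(congr1 (@^~ _)) E]].
exists nu; split => //; rewrite /edl.
by under eq_eseriesr do rewrite E.
Qed.

Lemma AST_sub : AST stp <-> AST sub.
Proof.
split=> ast mu muP.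
  by under eq_fun do rewrite nf_prob_sub; exact/ast/dlift_seq_sub.
by have [nu [nuP _ <-]] := strategy_simulation muP; exact: ast.
Qed.

Lemma PAST_sub : PAST stp <-> PAST sub.
Proof.
split=> past mu a muP mu0.
  by rewrite edl_sub; exact: past (dlift_seq_sub muP) mu0.
have [nu [nuP nu0 <-]] := strategy_simulation_edl muP.
by apply: past nuP _; rewrite nu0; exact: mu0.
Qed.

Lemma edh_sub a : edh sub a = edh stp a.
Proof.
congr ereal_sup; apply/seteqP; split=> _ [mu [muP mu0] <-].
  by exists mu; [split => //; exact: dlift_seq_sub | rewrite edl_sub].
have [nu [nuP nu0 <-]] := strategy_simulation_edl muP.
by exists nu => //; split => //; rewrite nu0.
Qed.

Lemma SAST_sub : SAST stp <-> SAST sub.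
Proof. by split=> sast a; have := sast a; rewrite edh_sub. Qed.

End Strategy.
End RandomDescent.

(** * Substitutions, positions and parallel replacement *)

Section TermPositions.
Context {F : Type} {ar : F -> nat}.

Lemma subterm_at_nil V (t : term ar V) : subterm_at t [::] = Some t.
Proof. by case: t. Qed.

(** The type of the arguments depends on [f], so constructor injectivity alone gives only an
    equality of dependent pairs; reading off each argument with [subterm_at] avoids this. *)
Lemma App_inj V (f : F) (ts us : 'I_(ar f) -> term ar V) :
  App f ts = App f us -> ts = us.
Proof.
move=> E; apply/funext => i.
have : subterm_at (App f ts) [:: val i] = subterm_at (App f us) [:: val i].
  by rewrite E.
by rewrite /= valK !subterm_at_nil => -[].
Qed.

Lemma subst_comp V W X (sigma : V -> term ar W) (theta : W -> term ar X)
    (t : term ar V) :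
  subst theta (subst sigma t) = subst (subst theta \o sigma) t.
Proof. by elim: t => [//|f ts IH] /=; congr App; apply/funext => i. Qed.

Lemma eq_in_subst V W (sigma theta : V -> term ar W) (t : term ar V) :
  (forall x, vars t x -> sigma x = theta x) -> subst sigma t = subst theta t.
Proof.
elim: t => [x|f ts IH] /= E; first exact: E.
congr App; apply/funext => i; apply: IH => x xi; apply: E.
by exists i.
Qed.

Lemma subst_inj_vars V W (sigma theta : V -> term ar W) (t : term ar V) :
  subst sigma t = subst theta t -> forall x, vars t x -> sigma x = theta x.
Proof.
elim: t => [x|f ts IH] /= E y; first by move=> ->.
by move=> [i _]; apply: IH; have /(congr1 (@^~ i)) := App_inj E.
Qed.

Lemma unify_apart_inst V (sigma theta : V -> term ar V) (s t : term ar V) :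
  subst sigma s = subst theta t -> unify_apart s t.
Proof.
(* The unifier acts as [sigma] on the left copy and as [theta] on the right one; [inl] then embeds
   the results into terms over [V + V]. *)
move=> E; exists (fun x => subst (Var \o inl)
  (match x with inl y => sigma y | inr y => theta y end)).
have {}E := congr1 (subst (Var \o inl : V -> term ar (V + V)%type)) E.
by move: E; rewrite !subst_comp.
Qed.

Lemma subterm_at_cat V (t : term ar V) (pi tau : seq nat) :
  subterm_at t (pi ++ tau) = obind (fun u => subterm_at u tau) (subterm_at t pi).
Proof.
elim: pi t => [|i pi IH] t; first by rewrite subterm_at_nil.
by case: t => //= f ts; case: insub.
Qed.

Definition parallel (pi tau : seq nat) : Prop :=
  left_of pi tau \/ left_of tau pi.

Lemma parallel_sym pi tau : parallel pi tau -> parallel tau pi.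
Proof. by case; [right|left]. Qed.

Lemma position_cases (pi tau : seq nat) :
  [\/ exists rho, tau = pi ++ rho, exists rho, pi = tau ++ rho |
      parallel pi tau].
Proof.
elim: pi tau => [|i pi IH] [|j tau]; try by constructor 1; eexists.
  by constructor 2; eexists.
have [lij|lji|->] := ltngtP i j.
- by constructor 3; left; exists [::], pi, tau, i, j.
- by constructor 3; right; exists [::], tau, pi, j, i.
have [[rho ->]|[rho ->]|] := IH tau.
- by constructor 1; exists rho.
- by constructor 2; exists rho.
case=> -[rho [p [q [k [l [-> -> kl]]]]]]; constructor 3.
  by left; exists (j :: rho), p, q, k, l.
by right; exists (j :: rho), p, q, k, l.
Qed.

Lemma parallelP pi tau : parallel pi tau ->
  exists rho i j pi' tau', [/\ pi = rho ++ i :: pi', tau = rho ++ j :: tau' & i != j].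
Proof.
case=> -[rho [p [q [i [j [-> -> ij]]]]]].
  by exists rho, i, j, p, q; rewrite neq_ltn ij.
by exists rho, j, i, q, p; rewrite neq_ltn ij orbT.
Qed.

Lemma subterm_at_replace V (s u : term ar V) (pi tau : seq nat) :
  parallel pi tau -> subterm_at (replace_at s pi u) tau = subterm_at s tau.
Proof.
move=> /parallelP[rho [i [j [pi' [tau' [-> -> ij]]]]]].
elim: rho s => [|k rho IH] [x//|f ts] /=; case: insubP => // l _ lE.
  by rewrite ifN// lE eq_sym.
by rewrite lE eqxx IH.
Qed.

(** Below the common prefix the two replacements act on different arguments. *)
Lemma replace_at_parallel V (s u v : term ar V) (pi tau : seq nat) :
  parallel pi tau ->
  replace_at (replace_at s pi u) tau v = replace_at (replace_at s tau v) pi u.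
Proof.
move=> /parallelP[rho [i [j [pi' [tau' [-> -> ij]]]]]].
elim: rho s => [|k rho IH] [x//|f ts] /=; congr App; apply/funext => l.
  by case: (eqVneq (val l) i) => [->|//]; rewrite (negPf ij).
case: ifP => E; rewrite ?E // IH.
Qed.

End TermPositions.

(** * Innermost and leftmost-innermost steps *)

Section Innermost.
Context {R : realType} {F : Type} {ar : F -> nat} {V : Type}.
Variable P : set (rule R ar V).
Hypothesis hP : is_PTRS P.
Implicit Types (s t : term ar V) (mu : multidist R (term ar V)).

Lemma normal_form_noredex t :
  (forall pi u, subterm_at t pi = Some u -> ~ redex P u) ->
  normal_form (step P) t.
Proof.
move=> nored [mu [pi [r [sigma [Pr tpi _]]]]].
by apply: nored tpi _; exists r, sigma.
Qed.

Lemma redex_not_nf t : redex P t -> ~ normal_form (step P) t.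
Proof.
move=> [r [sigma [Pr tE]]]; apply; eexists; exists [::], r, sigma.
by split; [exact: Pr | rewrite subterm_at_nil tE | reflexivity].
Qed.

Lemma istep_FDist s mu : istep P s mu -> FDist mu.
Proof.
move=> [pi [r [sigma [[Pr _ ->] _]]]]; apply: FDist_map.
by have [] := hP.2 r Pr.
Qed.

Lemma listep_istep s mu : listep P s mu -> istep P s mu.
Proof. by move=> [pi [r [sigma [h _]]]]; exists pi, r, sigma. Qed.

(** Structural induction: descend into the first argument that contains a redex; if there is none,
    the redex is the whole term, and it is innermost. *)
Lemma redex_listep t pi u :
  subterm_at t pi = Some u -> redex P u -> exists mu, listep P t mu.
Proof.
elim: t pi u => [x|f ts IH] pi u.
  (* A variable is no instance of a non-variable left-hand side. *)
  case: pi => [|//] [<-] [r [sigma [Pr xE]]].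
  by have [+ _ _] := hP.2 r Pr; case: r.1 xE.
move=> tpi ured.
pose hasred i := `[< exists pi u, subterm_at (ts i) pi = Some u /\ redex P u >].
have [[i0 i0red]|nored] := pselect (exists i, hasred i).
  case: (arg_minnP (fun i : 'I_(ar f) => val i) i0red) => i /asboolP.
  move=> [pi' [u' [ipi' u'red]]] imin.
  have [mu [rho [r [sigma [[[Pr irho _] inn] left]]]]] := IH _ _ _ ipi' u'red.
  eexists; exists (val i :: rho), r, sigma; split.
    split; last exact: inn.
    by split; [exact: Pr | rewrite /= valK | reflexivity].
  (* A position to the left either enters an earlier argument, against the minimality of [i], or
     lies in argument [i] itself, where the induction hypothesis applies. *)
  move=> tau v [[|k om] [tau' [rho' [m [m' [-> [E1 E2] lt]]]]]] /=.
    case: insubP => // l _ lE tauv vred; have := imin l.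
    rewrite leqNgt; move: lt; rewrite -lE -E1 => -> /(_ _)/negP; case => //.
    by apply/asboolP; exists tau', v.
  rewrite -E1 valK; apply: left.
  by exists om, tau', rho', m, m'.
have {}nored i rho v : subterm_at (ts i) rho = Some v -> ~ redex P v.
  by move=> iv vred; apply: nored; exists i; apply/asboolP; exists rho, v.
case: pi tpi => [[uE]|i pi] /=; last by case: insub => // j /nored.
move: ured; rewrite -uE => -[r [sigma [Pr tE]]].
eexists; exists [::], r, sigma; split; last first.
  by move=> tau v [[|? ?] [? [? [? [? []]]]]].
split; first by split; [exact: Pr | rewrite subterm_at_nil tE | reflexivity].
rewrite -tE => -[|i tau] v //= _; case: insub => // j jv.
apply: normal_form_noredex => rho w vw; apply: (nored j (tau ++ rho)).
by rewrite subterm_at_cat jv.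
Qed.

Lemma istep_listep s mu : istep P s mu -> exists nu, listep P s nu.
Proof.
move=> [pi [r [sigma [[Pr spi _] _]]]].
by apply: redex_listep spi _; exists r, sigma.
Qed.

Hypothesis hno : nonoverlapping P.

(** Two different rules matching the same term would overlap at the root. *)
Lemma redex_rule_unique r1 r2 (sigma1 sigma2 : V -> term ar V) : P r1 -> P r2 ->
  subst sigma1 r1.1 = subst sigma2 r2.1 -> r1 = r2.
Proof.
move=> Pr1 Pr2 E; apply: contrapT => ne.
have [nv _ _] := hP.2 r1 Pr1.
by apply: (hno Pr1 Pr2 (subterm_at_nil _) nv) => //; exact: unify_apart_inst E.
Qed.

(** The substitutions agree on the variables of the left-hand side, and these include all variables
    of the right-hand sides. *)
Lemma redex_contractum_unique r1 r2 (sigma1 sigma2 : V -> term ar V) : P r1 -> P r2 ->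
  subst sigma1 r1.1 = subst sigma2 r2.1 ->
  r1 = r2 /\ forall x, x \in enum_mset r1.2 -> subst sigma1 x.2 = subst sigma2 x.2.
Proof.
move=> Pr1 Pr2 E; have r12 := redex_rule_unique Pr1 Pr2 E; subst r2.
split=> // x xr; apply: eq_in_subst => y yx.
by apply: subst_inj_vars E _ _; have [_ _] := hP.2 r1 Pr1; apply; eauto.
Qed.

(** If one position were strictly below the other, its redex would be a proper subterm of an
    innermost redex, hence a normal form. *)
Lemma innermost_positions s pi1 pi2 r1 r2 sigma1 sigma2 mu1 mu2 :
  innermost_at P pi1 r1 sigma1 s mu1 -> innermost_at P pi2 r2 sigma2 s mu2 ->
  pi1 = pi2 \/ parallel pi1 pi2.
Proof.
move=> [[Pr1 s1 _] nf1] [[Pr2 s2 _] nf2].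
have [[rho]|[rho]|] := position_cases pi1 pi2; last by right.
- case: rho => [|i rho] E; first by left; rewrite E cats0.
  case: (@redex_not_nf (subst sigma2 r2.1)); first by exists r2, sigma2.
  by apply: (nf1 (i :: rho)) => //; rewrite -s2 E subterm_at_cat s1.
- case: rho => [|i rho] E; first by left; rewrite E cats0.
  case: (@redex_not_nf (subst sigma1 r1.1)); first by exists r1, sigma1.
  by apply: (nf2 (i :: rho)) => //; rewrite -s1 E subterm_at_cat s2.
Qed.

(** Innermostness depends only on the contracted subterm, which a parallel step leaves intact. *)
Lemma istep_after_parallel s pi1 pi2 r1 r2 sigma1 sigma2 mu1 mu2 :
  parallel pi1 pi2 ->
  innermost_at P pi1 r1 sigma1 s mu1 -> innermost_at P pi2 r2 sigma2 s mu2 ->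
  forall x, x \in enum_mset mu1 ->
  istep P x.2 (map_mdist (fun t => replace_at x.2 pi2 (subst sigma2 t)) r2.2).
Proof.
move=> par [[_ _ ->] _] [[Pr2 s2 _] nf2] x.
rewrite (perm_mem (perm_eq_seq_mset _)) => /mapP[y _ ->] /=.
exists pi2, r2, sigma2; split => //; split => //.
by rewrite subterm_at_replace.
Qed.

Lemma istep_diamond : diamond (istep P).
Proof.
move=> s mu1 mu2 [pi1 [r1 [sigma1 h1]]] [pi2 [r2 [sigma2 h2]]].
have [E|par] := innermost_positions h1 h2.
  left; subst pi2; case: h1 h2 => [[Pr1 s1 ->] _] [[Pr2 s2 ->] _].
  have [|r12 Es] := redex_contractum_unique (sigma1 := sigma1)
    (sigma2 := sigma2) Pr1 Pr2; first by move: s2; rewrite s1 => -[].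
  rewrite -r12 /map_mdist; congr seq_mset; apply/eq_in_map => x xr.
  by rewrite Es.
(* Each side is joined by contracting the redex that the other side has contracted. *)
right; exists (fun b => map_mdist (fun t => replace_at b pi2 (subst sigma2 t)) r2.2).
exists (fun b => map_mdist (fun t => replace_at b pi1 (subst sigma1 t)) r1.2).
split.
- exact: istep_after_parallel par h1 h2.
- exact: istep_after_parallel (parallel_sym par) h2 h1.
move=> g; case: h1 h2 => [[_ _ ->] _] [[_ _ ->] _].
rewrite !expect_map.
(* Both sides are double sums over [r1.2] and [r2.2]; they agree after exchanging the sums and
   commuting the parallel replacements. *)
transitivity (expect r1.2 (fun t => expect r2.2 (fun u =>
  g (replace_at (replace_at s pi1 (subst sigma1 t)) pi2 (subst sigma2 u))))).
  by apply: eq_expect => x _; rewrite /= expect_map.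
rewrite exchange_expect; apply: eq_expect => x _; rewrite /= expect_map.
apply: eq_expect => y _ /=.
by rewrite replace_at_parallel.
Qed.

End Innermost.

Theorem theorem4p11 (R : realType) (F : countType) (ar : F -> nat)
    (V : countType) (P : set (rule R ar V)) (hP : is_PTRS P)
    (hno : nonoverlapping P) :
  [/\ AST (istep P) <-> AST (listep P),
      PAST (istep P) <-> PAST (listep P) &
      SAST (istep P) <-> SAST (listep P)].
Proof.
have sub := @listep_istep R F ar V P.
have ex := istep_listep hP.
have FD := istep_FDist hP.
have dia := istep_diamond hP hno.
by split; [exact: AST_sub | exact: PAST_sub | exact: SAST_sub].
Qed.
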